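(* Let $\mathcal{C}$ be a discriminator clone of Boolean functions (i.e. a discriminator clone on $A=\{0,1\}$). The following conditions on $f\in\mathcal{O}^{(n)}$ and $g\in\mathcal{O}^{(m)}$ are equivalent: (a) $f\leq_{\mathcal{C}}g$; (b) $f(\mathbf{0})=g(\mathbf{0})$ if $\mathcal{C}\subseteq\mathcal{T}_0$, $f(\mathbf{1})=g(\mathbf{1})$ if $\mathcal{C}\subseteq\mathcal{T}_1$, and $\mathrm{Im}^{[d_{\mathcal{C}}]}(f)\subseteq\mathrm{Im}^{[d_{\mathcal{C}}]}(g)$. Moreover, if $\mathcal{C}=\mathcal{T}_{\mathrm{id}}$, $\mathcal{T}_0$, $\mathcal{T}_1$, or $\mathcal{O}$, then the inclusion $\mathrm{Im}^{[d_{\mathcal{C}}]}(f)\subseteq\mathrm{Im}^{[d_{\mathcal{C}}]}(g)$ in condition (b) can be replaced by $\mathrm{Im}(f)\subseteq\mathrm{Im}(g)$.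
   Context: Let $A=\{0,1\}$. For $n\ge1$, $\mathcal{O}^{(n)}$ is the set of all functions $A^n\to A$ ($n$-ary Boolean functions), and $\mathcal{O}=\bigcup_{n\ge1}\mathcal{O}^{(n)}$. An $m$-tuple $\mathbf{h}=(h_1,\dots,h_m)$ of $n$-ary operations is identified with the function $\mathbf{h}\colon A^n\to A^m$, and $g\circ\mathbf{h}=g(h_1,\dots,h_m)$ for $g\in\mathcal{O}^{(m)}$. A clone on $A$ is a set $\mathcal{C}\subseteq\mathcal{O}$ containing all projections $p_i^{(n)}(a_1,\dots,a_n)=a_i$ and closed under composition ($g\circ\mathbf{h}\in\mathcal{C}$ whenever $g\in\mathcal{C}$ is $m$-ary and $\mathbf{h}$ is an $m$-tuple of $n$-ary members of $\mathcal{C}$); $\mathcal{C}^{(n)}$ is the set of its $n$-ary members. For $f\in\mathcal{O}^{(n)}$, $g\in\mathcal{O}^{(m)}$, $f\leq_{\mathcal{C}}g$ means $f=g\circ\mathbf{h}$ for some $\mathbf{h}\in(\mathcal{C}^{(n)})^m$. The discriminator function on $A$ is the ternary operation $t$ with $t(x,y,z)=z$ if $x=y$ and $t(x,y,z)=x$ otherwise; a discriminator clone is a clone containing $t$. $\mathbf{0}$ and $\mathbf{1}$ denote the tuples $(0,\dots,0)$ and $(1,\dots,1)$ (of the appropriate length), and $\overline{\mathbf{a}}$ is the tuple obtained from $\mathbf{a}\in A^n$ by negating every coordinate. $\mathcal{T}_0=\{f\in\mathcal{O}:f(\mathbf{0})=0\}$, $\mathcal{T}_1=\{f\in\mathcal{O}:f(\mathbf{1})=1\}$,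 $\mathcal{T}_{\mathrm{id}}=\mathcal{T}_0\cap\mathcal{T}_1$, and $\mathcal{S}=\{f\in\mathcal{O}:f(\overline{\mathbf{x}})=\overline{f(\mathbf{x})}\text{ for all }\mathbf{x}\}$. Put $d_{\mathcal{C}}=2$ if $\mathcal{C}\subseteq\mathcal{S}$, and $d_{\mathcal{C}}=1$ otherwise. For a Boolean function $f$ of arity $n$, $\mathrm{Im}^{[2]}(f)=\{\{f(\mathbf{a}),f(\overline{\mathbf{a}})\}:\mathbf{a}\in A^n\}$, $\mathrm{Im}^{[1]}(f)=\{\{f(\mathbf{a})\}:\mathbf{a}\in A^n\}$, and $\mathrm{Im}(f)$ is the range of $f$. *)

(* Defs.v *)
From mathcomp Require Import all_boot.
From mathcomp Require Import boolp classical_sets.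
Set Implicit Arguments.
Unset Strict Implicit.
Unset Printing Implicit Defensive.

(* The two-element set A = {0,1} is rendered as bool. *)

Definition op (n : nat) : Type := {ffun n.-tuple bool -> bool}.

(* Operations of different arities are kept distinct.  Arity 0 is excluded not
   by this type but by [allops] below. *)
Definition bool_op : Type := {n : nat & op n}.

Definition mkop (n : nat) (f : op n) : bool_op := Tagged op f.

Definition const_tuple (n : nat) (b : bool) : n.-tuple bool := [tuple b | i < n].

Definition neg_tuple (n : nat) (a : n.-tuple bool) : n.-tuple bool :=
  [tuple ~~ tnth a i | i < n].

Definition comp_op (m n : nat) (g : op m) (h : m.-tuple (op n)) : op n :=
  [ffun a => g [tuple (tnth h i) a | i < m]].

Definition proj_op (n : nat) (i : 'I_n) : op n := [ffun a => tnth a i].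

Definition discriminator : op 3 :=
  [ffun a : 3.-tuple bool =>
     let x := nth false a 0 in
     let y := nth false a 1 in
     let z := nth false a 2 in
     if x == y then z else x].

Definition allops : set bool_op := [set F : bool_op | 0 < tag F]%classic.

Definition is_clone (C : set bool_op) : Prop :=
  [/\ (C `<=` allops)%classic,
      forall (n : nat) (i : 'I_n), C (mkop (proj_op i))
    & forall (m n : nat) (g : op m) (h : m.-tuple (op n)),
        C (mkop g) -> (forall i : 'I_m, C (mkop (tnth h i))) ->
        C (mkop (comp_op g h))].

Definition is_discriminator_clone (C : set bool_op) : Prop :=
  is_clone C /\ C (mkop discriminator).

Definition le_clone (C : set bool_op) (n m : nat) (f : op n) (g : op m) : Prop :=
  exists h : m.-tuple (op n),
    (forall i : 'I_m, C (mkop (tnth h i))) /\ f = comp_op g h.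

Definition T0 : set bool_op :=
  (allops `&` [set F : bool_op | tagged F (const_tuple (tag F) false) = false])%classic.

Definition T1 : set bool_op :=
  (allops `&` [set F : bool_op | tagged F (const_tuple (tag F) true) = true])%classic.

Definition Tid : set bool_op := (T0 `&` T1)%classic.

Definition selfdual : set bool_op :=
  (allops `&` [set F : bool_op | forall a : (tag F).-tuple bool,
                         tagged F (neg_tuple a) = ~~ tagged F a])%classic.

Definition d_of (C : set bool_op) : nat :=
  if `[< (C `<=` selfdual)%classic >] then 2 else 1.

Definition Im (n : nat) (f : op n) : {set bool} :=
  [set f a | a : n.-tuple bool]%SET.

Definition Im1 (n : nat) (f : op n) : {set {set bool}} :=
  [set [set f a]%SET | a : n.-tuple bool]%SET.

Definition Im2 (n : nat) (f : op n) : {set {set bool}} :=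
  [set [set f a; f (neg_tuple a)]%SET | a : n.-tuple bool]%SET.

(* Only d = 1 and d = 2, the possible values of [d_of], are meaningful. *)
Definition Imd (d : nat) (n : nat) (f : op n) : {set {set bool}} :=
  if d == 2 then Im2 f else Im1 f.

(* Main.v *)
Require Import Defs.
From mathcomp Require Import all_boot.
From mathcomp Require Import boolp classical_sets.

Set Implicit Arguments.
Unset Strict Implicit.
Unset Printing Implicit Defensive.

(** Two facts carry the proof.

    Membership ([mem_discriminator_clone]).  An operation [f] of positive arity
    belongs to a discriminator clone [C] as soon as it has each of the following
    properties that all members of [C] share: fixing the tuple [0], fixing the
    tuple [1], being self-dual.  Since
    [t(x, t(x,y,z), z)] is the majority operation, the Baker-Pixley argument
    ([interp_seq]) reduces this to finding, for any two points [a] and [b], a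
    member of [C] that agrees with [f] at both.  The set [D] of pairs
    [(c a, c b)] with [c] in [C] is closed under the operations of [C].  Both
    projections of [D] contain the required value; when [a] and [b] differ, some
    coordinate puts an off-diagonal pair in [D]; and if [D] has both off-diagonal
    pairs, it also has a diagonal one unless [b] is the negation of [a] and [C]
    consists of self-dual operations.
    A few applications of the discriminator then reach the required pair.

    Lifting ([lift_le_clone]).  By the first fact, [f] lies below [g] once there
    is a map [H] with [g (H a) = f a] that respects the constant tuples and the
    negation as far as [C] does.  The condition on images gives a suitable value
    of [H] at each point; if [C] is self-dual, the values are chosen at the
    tuples with first coordinate [0] and extended by duality. *)

Local Open Scope classical_set_scope.

(** * Boolean tuples and the discriminator *)

Lemma neg_tupleK n : involutive (@neg_tuple n).
Proof. by move=> a; apply: eq_from_tnth => i; rewrite !tnth_mktuple negbK. Qed.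

Lemma tnth_const_tuple n b i : tnth (const_tuple n b) i = b.
Proof. by rewrite tnth_mktuple. Qed.

Lemma neg_const_tuple n b : neg_tuple (const_tuple n b) = const_tuple n (~~ b).
Proof. by apply: eq_from_tnth => i; rewrite !tnth_mktuple. Qed.

(** The discriminator as a curried function. *)
Definition discr (x y z : bool) : bool := if x == y then z else x.

(** The majority operation. *)
Definition maj (x y z : bool) : bool := discr x (discr x y z) z.

Lemma comp_discriminatorE n (h1 h2 h3 : op n) a :
  comp_op discriminator [tuple h1; h2; h3] a = discr (h1 a) (h2 a) (h3 a).
Proof.
rewrite ffunE.
have -> : [tuple (tnth [tuple h1; h2; h3] i) a | i < 3] = [tuple h1 a; h2 a; h3 a].
  apply: eq_from_tnth => i; rewrite tnth_mktuple !(tnth_nth h1, tnth_nth false).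
  by case: i => -[|[|[|]]].
by rewrite ffunE.
Qed.

Lemma neq_negb (x y : bool) : x <> y -> x = ~~ y.
Proof. by case: x; case: y. Qed.

(** * Membership in a discriminator clone *)

(** Some [n]-ary member of [C] agrees with [f] at all points of [s]. *)
Definition interp (C : set bool_op) n (f : op n) (s : seq (n.-tuple bool)) :=
  exists2 c : op n, C (mkop c) & {in s, c =1 f}.

(** [(u, v)] is the pair of values at [a] and [b] of some member of [C]. *)
Definition pair_val (C : set bool_op) n (a b : n.-tuple bool) (u v : bool) :=
  exists2 c : op n, C (mkop c) & c a = u /\ c b = v.

Lemma pair_val_sym C n (a b : n.-tuple bool) u v :
  pair_val C a b u v -> pair_val C b a v u.
Proof. by case=> c Cc [? ?]; exists c. Qed.

Section Clone.

Variables (C : set bool_op) (hC : is_discriminator_clone C).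

Lemma clone_proj n (i : 'I_n) : C (mkop (proj_op i)).
Proof. by case: hC => -[]. Qed.

Lemma clone_comp m n (g : op m) (h : m.-tuple (op n)) :
  C (mkop g) -> (forall i, C (mkop (tnth h i))) -> C (mkop (comp_op g h)).
Proof. by case: hC => -[_ _ + _]; apply. Qed.

Lemma clone_gt0 n (f : op n) : C (mkop f) -> 0 < n.
Proof. by case: hC => -[sub _ _] _ /sub. Qed.

Lemma clone_discriminator n (h1 h2 h3 : op n) :
  C (mkop h1) -> C (mkop h2) -> C (mkop h3) ->
  C (mkop (comp_op discriminator [tuple h1; h2; h3])).
Proof.
move=> C1 C2 C3; apply: clone_comp; first by case: hC.
by move=> i; rewrite (tnth_nth h1); case: i => -[|[|[|]]].
Qed.

Lemma clone_maj n (h1 h2 h3 : op n) :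
  C (mkop h1) -> C (mkop h2) -> C (mkop h3) ->
  exists2 c : op n, C (mkop c) & forall a, c a = maj (h1 a) (h2 a) (h3 a).
Proof.
move=> C1 C2 C3.
exists (comp_op discriminator
  [tuple h1; comp_op discriminator [tuple h1; h2; h3]; h3]).
  by apply: clone_discriminator => //; apply: clone_discriminator.
by move=> a; rewrite !comp_discriminatorE.
Qed.

(** Baker-Pixley: by the majority operation, agreement at any two points gives
    agreement at any finite set of points. *)
Lemma interp_seq n (f : op n) :
  (forall a b, interp C f [:: a; b]) -> forall s, interp C f s.
Proof.
move=> f2 s; have [k] := ubnP (size s); elim: k s => // k IHk.
case=> [|a [|b [|c s]]] ltsk.
- (* A member of [C] of arity [n] is needed even for the empty sequence. *)
  by have [h Ch _] := f2 (const_tuple n false) (const_tuple n false); exists h.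
- have [h Ch hE] := f2 a a; exists h => // x xa; apply: hE.
  by move: xa; rewrite !inE => ->.
- exact: f2.
have [h1 C1 E1] := IHk (b :: c :: s) ltsk.
have [h2 C2 E2] := IHk (a :: c :: s) ltsk.
have [h3 C3 E3] := IHk (a :: b :: s) ltsk.
have [h Ch hE] := clone_maj C1 C2 C3.
have maj_eq (u v w y : bool) :
    [\/ v = y /\ w = y, u = y /\ w = y | u = y /\ v = y] -> maj u v w = y.
  by move: u v w y => [] [] [] [] -[] [].
(* Each point of the sequence is missed by at most one of the three. *)
exists h => // x xs; rewrite hE; apply: maj_eq; move: xs; rewrite !inE.
case/or4P => xs; [apply: Or31|apply: Or32|apply: Or33|apply: Or31];
  by split; [apply: E1 || apply: E2|apply: E3 || apply: E2];
     rewrite !inE xs ?orbT.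
Qed.

Lemma interp_mem n (f : op n) :
  (forall a b, interp C f [:: a; b]) -> C (mkop f).
Proof.
move=> f2; have [c Cc cE] := interp_seq f2 (enum {: n.-tuple bool}).
by have <- : c = f by apply/ffunP => a; apply: cE; rewrite mem_enum.
Qed.

Section PairVal.

Variables (n : nat) (a b : n.-tuple bool).

Lemma pair_val_proj i : pair_val C a b (tnth a i) (tnth b i).
Proof. by exists (proj_op i); [exact: clone_proj | rewrite !ffunE]. Qed.

Lemma pair_val_discr u1 v1 u2 v2 u3 v3 :
  pair_val C a b u1 v1 -> pair_val C a b u2 v2 -> pair_val C a b u3 v3 ->
  pair_val C a b (discr u1 u2 u3) (discr v1 v2 v3).
Proof.
move=> [h1 C1 [<- <-]] [h2 C2 [<- <-]] [h3 C3 [<- <-]].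
exists (comp_op discriminator [tuple h1; h2; h3]).
  exact: clone_discriminator.
by rewrite !comp_discriminatorE.
Qed.

Lemma pair_val_comp k (g : op k) (u v : k.-tuple bool) :
  C (mkop g) -> (forall i, pair_val C a b (tnth u i) (tnth v i)) ->
  pair_val C a b (g u) (g v).
Proof.
move=> Cg uv.
have /choice[h hP] : forall i, exists c : op n,
    [/\ C (mkop c), c a = tnth u i & c b = tnth v i].
  by move=> i; have [c ? []] := uv i; exists c.
exists (comp_op g [tuple h i | i < k]).
  by apply: clone_comp => // i; rewrite tnth_mktuple; have [] := hP i.
by split; rewrite ffunE; congr (g _); apply: eq_from_tnth => i;
  rewrite !tnth_mktuple; have [] := hP i.
Qed.

End PairVal.

(** If [f] fixes the constant tuples that [C] fixes, then at each single point
    some member of [C] agrees with [f]. *)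
Lemma pair_val_point n (f : op n) (a b : n.-tuple bool) : 0 < n ->
  (C `<=` T0 -> f (const_tuple n false) = false) ->
  (C `<=` T1 -> f (const_tuple n true) = true) ->
  exists v, pair_val C a b (f a) v.
Proof.
move=> n0 f0 f1.
have [[i ai]|na] := pselect (exists i, tnth a i = f a).
  by exists (tnth b i); rewrite -ai; apply: pair_val_proj.
have aE : a = const_tuple n (~~ f a).
  apply: eq_from_tnth => i; rewrite tnth_const_tuple.
  by apply: neq_negb => e; apply: na; exists i.
(* The tuple [a] is constant and [f] moves its entry, so some [g] in [C] does. *)
have [k [g [Cg gE]]] : exists k (g : op k),
    C (mkop g) /\ g (const_tuple k (~~ f a)) = f a.
  apply: contrapT => nog.
  have sub : forall F, C F -> tagged F (const_tuple (tag F) (~~ f a)) = ~~ f a.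
    by move=> [k g] Cg /=; apply: neq_negb => e; apply: nog; exists k, g.
  have gt0 : forall F, C F -> 0 < tag F by move=> [k g] /clone_gt0.
  case fa : (f a) sub aE => /= sub aE.
    by move: fa; rewrite aE f0 // => F CF; split; [exact: gt0 | exact: sub].
  by move: fa; rewrite aE f1 // => F CF; split; [exact: gt0 | exact: sub].
pose i0 := Ordinal n0.
exists (g (const_tuple k (tnth b i0))); rewrite -{1}gE.
apply: pair_val_comp => // i; rewrite !tnth_const_tuple.
by have := pair_val_proj a b i0; rewrite {2}aE tnth_const_tuple.
Qed.

(** When both off-diagonal pairs are available, so is a diagonal one, unless
    self-duality forbids it. *)
Lemma pair_val_diag n (a b : n.-tuple bool) :
  (C `<=` selfdual -> b <> neg_tuple a) ->
  (forall x, pair_val C a b x (~~ x)) ->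
  exists x, pair_val C a b x x.
Proof.
move=> ndual off.
have [Cdual|nCdual] := pselect (C `<=` selfdual).
  apply: contrapT => nD; apply: (ndual Cdual).
  apply: eq_from_tnth => i; rewrite tnth_mktuple; apply: neq_negb => e.
  by apply: nD; exists (tnth a i); rewrite -{2}e; apply: pair_val_proj.
have [k [g [Cg [e ge]]]] : exists k (g : op k),
    C (mkop g) /\ exists e, g (neg_tuple e) = g e.
  apply: contrapT => nog; apply: nCdual => -[k g] Cg.
  split; first exact: (clone_gt0 Cg).
  by move=> /= e; apply: neq_negb => ge; apply: nog; exists k, g; split=> //; exists e.
exists (g e); rewrite -{2}ge; apply: pair_val_comp => // i.
by rewrite tnth_mktuple.
Qed.

(** The only obstructions to membership in [C] are the subalgebras [{0}] and
    [{1}] and the automorphism that negation may provide. *)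
Lemma mem_discriminator_clone n (f : op n) : 0 < n ->
  (C `<=` T0 -> f (const_tuple n false) = false) ->
  (C `<=` T1 -> f (const_tuple n true) = true) ->
  (C `<=` selfdual -> forall a, f (neg_tuple a) = ~~ f a) ->
  C (mkop f).
Proof.
move=> n0 f0 f1 fdual; apply: interp_mem => a b.
have [v' Duv'] := pair_val_point a b n0 f0 f1.
have [->|neq_ab] := eqVneq b a.
  case: Duv' => c Cc [ca _]; exists c => // x.
  by rewrite !inE orbb => /eqP->.
suff [c Cc [ca cb]] : pair_val C a b (f a) (f b).
  by exists c => // x; rewrite !inE => /orP[] /eqP->.
have [u' /pair_val_sym Du'v] := pair_val_point b a n0 f0 f1.
apply: contrapT => nD.
have v'E : v' = ~~ f b by apply: neq_negb => e; apply: nD; rewrite -e.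
have u'E : u' = ~~ f a by apply: neq_negb => e; apply: nD; rewrite -e.
rewrite {}v'E {}u'E in Duv' Du'v.
have [fab|/eqP/nesym/neq_negb fab] := eqVneq (f a) (f b).
  (* With [u = f a], [D] contains [(u, ~~ u)], [(~~ u, u)] and some diagonal
     pair; as [(u, u)] is missing, this pair is [(~~ u, ~~ u)]. *)
  rewrite -fab in Duv' Du'v nD.
  have [w Dww] : exists w, pair_val C a b w w.
    apply: pair_val_diag.
      by move=> /fdual/(_ a) fa ba; move: fab; rewrite ba fa; case: (f a).
    by move=> x; case: (f a) Duv' Du'v => /= ? ?; case: x.
  have wE : w = ~~ f a by apply: neq_negb => e; apply: nD; rewrite -e.
  rewrite {}wE in Dww; apply: nD.
  by have := pair_val_discr Du'v Dww Duv'; rewrite /discr; case: (f a).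
(* Here [D] contains [(u, u)], [(~~ u, ~~ u)] and an off-diagonal pair; the target is
   [(u, ~~ u)]. *)
rewrite fab negbK in Duv' Du'v nD.
have [x Dx] : exists x, pair_val C a b x (~~ x).
  apply: contrapT => noff; move/eqP: neq_ab; apply; apply: eq_from_tnth => i.
  apply: contrapT => /neq_negb bi.
  by apply: noff; exists (tnth a i); rewrite -bi; apply: pair_val_proj.
have xE : x = ~~ f a by apply: neq_negb => e; apply: nD; rewrite -e.
rewrite {}xE in Dx; apply: nD.
by have := pair_val_discr Duv' Dx Du'v; rewrite /discr; case: (f a).
Qed.

(** * The order below an operation *)

(** [f] lies below [g] once there is a map [H] of the points with [f = g \o H]
    that respects the constant tuples and the negation as far as [C] does. *)
Lemma lift_le_clone n m (f : op n) (g : op m)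
    (H : n.-tuple bool -> m.-tuple bool) : 0 < n ->
  (forall a, g (H a) = f a) ->
  (C `<=` T0 -> H (const_tuple n false) = const_tuple m false) ->
  (C `<=` T1 -> H (const_tuple n true) = const_tuple m true) ->
  (C `<=` selfdual -> forall a, H (neg_tuple a) = neg_tuple (H a)) ->
  le_clone C f g.
Proof.
move=> n0 gH H0 H1 Hdual.
exists [tuple [ffun a => tnth (H a) i] : op n | i < m]; split=> [i|].
  rewrite tnth_mktuple; apply: mem_discriminator_clone => //.
  - by move=> /H0 {}H0; rewrite ffunE H0 tnth_const_tuple.
  - by move=> /H1 {}H1; rewrite ffunE H1 tnth_const_tuple.
  - by move=> /Hdual {}Hdual a; rewrite !ffunE Hdual tnth_mktuple.
apply/ffunP => a; rewrite ffunE -gH; congr (g _).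
by apply: eq_from_tnth => i; rewrite !tnth_mktuple ffunE.
Qed.

Lemma selfdual_T0_T1 : C `<=` selfdual -> C `<=` T0 <-> C `<=` T1.
Proof.
move=> Cdual; split=> sub [k g] Cg; have [/= k0 gc] := sub _ Cg;
  have [_ /= gdual] := Cdual _ Cg; split=> //=.
  by rewrite -[true]/(~~ false) -neg_const_tuple gdual gc.
by rewrite -[false]/(~~ true) -neg_const_tuple gdual gc.
Qed.

(** The constraints that [C] puts on the value [b] at [a] of a map of points
    carrying [f] to [g]. *)
Definition lift_at n m (f : op n) (g : op m) a b :=
  [/\ g b = f a,
      C `<=` selfdual -> g (neg_tuple b) = f (neg_tuple a),
      C `<=` T0 -> a = const_tuple n false -> b = const_tuple m false
    & C `<=` T1 -> a = const_tuple n true -> b = const_tuple m true].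

Lemma lift_at_neg n m (f : op n) (g : op m) a b :
  C `<=` selfdual -> lift_at f g a b -> lift_at f g (neg_tuple a) (neg_tuple b).
Proof.
move=> Cdual [gb gnb b0 b1]; split; rewrite ?neg_tupleK; first exact: gnb.
- by [].
- move=> /(selfdual_T0_T1 Cdual)/b1 {}b1 /(congr1 (@neg_tuple n)).
  by rewrite neg_tupleK neg_const_tuple => /b1->; rewrite neg_const_tuple.
- move=> /(selfdual_T0_T1 Cdual)/b0 {}b0 /(congr1 (@neg_tuple n)).
  by rewrite neg_tupleK neg_const_tuple => /b0->; rewrite neg_const_tuple.
Qed.

(** Pointwise lifts can be chosen compatibly with negation. *)
Lemma lift_at_le_clone n m (f : op n) (g : op m) : 0 < n ->
  (forall a, exists b, lift_at f g a b) -> le_clone C f g.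
Proof.
move=> n0 /choice[H HP].
have [Cdual|nCdual] := pselect (C `<=` selfdual); last first.
  apply: (lift_le_clone (H := H)) => // [a|sub|sub].
  - by have [] := HP a.
  - by have [_ _ + _] := HP (const_tuple n false); apply.
  - by have [_ _ _ +] := HP (const_tuple n true); apply.
pose i0 := Ordinal n0.
pose H' a := if tnth a i0 then neg_tuple (H (neg_tuple a)) else H a.
have HP' a : lift_at f g a (H' a).
  rewrite /H'; case: ifP => _ //.
  by rewrite -{1}[a]neg_tupleK; apply: lift_at_neg.
apply: (lift_le_clone (H := H')) => // [a|sub|sub|_ a].
- by have [] := HP' a.
- by have [_ _ + _] := HP' (const_tuple n false); apply.
- by have [_ _ _ +] := HP' (const_tuple n true); apply.
by rewrite /H' tnth_mktuple neg_tupleK; case: (tnth a i0); rewrite /= ?neg_tupleK.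
Qed.

End Clone.

(** * Images *)

Lemma sub_Im1 n m (f : op n) (g : op m) :
  Im1 f \subset Im1 g <-> forall a, exists b, g b = f a.
Proof.
split=> [/fintype.subsetP sub a | sub].
  have /sub/imsetP[b _ e] : [set f a]%SET \in Im1 f by apply/imsetP; exists a.
  by exists b; apply/set1P; rewrite e inE.
apply/fintype.subsetP => _ /imsetP[a _ ->]; have [b <-] := sub a.
by apply/imsetP; exists b.
Qed.

Lemma sub_Im n m (f : op n) (g : op m) :
  Im f \subset Im g <-> forall a, exists b, g b = f a.
Proof.
split=> [/fintype.subsetP sub a | sub].
  have /sub/imsetP[b _ e] : f a \in Im f by apply/imsetP; exists a.
  by exists b.
apply/fintype.subsetP => _ /imsetP[a _ ->]; have [b <-] := sub a.
by apply/imsetP; exists b.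
Qed.

Lemma sub_Im2 n m (f : op n) (g : op m) :
  Im2 f \subset Im2 g <->
  forall a, exists b, g b = f a /\ g (neg_tuple b) = f (neg_tuple a).
Proof.
split=> [/fintype.subsetP sub a | sub].
  have /sub/imsetP[b _ /setP e] : [set f a; f (neg_tuple a)]%SET \in Im2 f.
    by apply/imsetP; exists a.
  (* The unordered pairs agree, so [b] or its negation is suitable. *)
  suff : (g b = f a /\ g (neg_tuple b) = f (neg_tuple a)) \/
         (g (neg_tuple b) = f a /\ g b = f (neg_tuple a)).
    by case=> ?; [exists b | exists (neg_tuple b); rewrite neg_tupleK].
  move: (e true) (e false); rewrite !inE.
  by case: (f a); case: (f _); case: (g b); case: (g _); auto.
apply/fintype.subsetP => _ /imsetP[a _ ->]; have [b [<- <-]] := sub a.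
by apply/imsetP; exists b.
Qed.

Lemma sub_Imd C n m (f : op n) (g : op m) :
  Imd (d_of C) f \subset Imd (d_of C) g <->
  forall a, exists b,
    g b = f a /\ (C `<=` selfdual -> g (neg_tuple b) = f (neg_tuple a)).
Proof.
rewrite /Imd /d_of; case: asboolP => Cdual /=.
  split=> [/sub_Im2 sub a | sub]; last apply/sub_Im2 => a.
    by have [b [? ?]] := sub a; exists b.
  by have [b [? ?]] := sub a; exists b; auto.
split=> [/sub_Im1 sub a | sub]; last apply/sub_Im1 => a.
  by have [b ?] := sub a; exists b.
by have [b [? _]] := sub a; exists b.
Qed.

(** Conjunction is idempotent but not self-dual. *)
Lemma Tid_not_selfdual : ~ Tid `<=` selfdual.
Proof.
pose conj_op : op 2 := [ffun a => tnth a ord0 && tnth a ord_max].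
move=> /(_ (mkop conj_op))[].
  by split; split=> //=; rewrite ffunE !tnth_const_tuple.
move=> _ /(_ [tuple true; false]) /=.
by rewrite !ffunE !tnth_mktuple.
Qed.

Theorem theorem5p1 (C : set bool_op) (hC : is_discriminator_clone C)
    (n m : nat) (hn : 0 < n) (hm : 0 < m) (f : op n) (g : op m) :
  (le_clone C f g <->
     [/\ ((C `<=` T0)%classic ->
            f (const_tuple n false) = g (const_tuple m false)),
         ((C `<=` T1)%classic ->
            f (const_tuple n true) = g (const_tuple m true))
       & Imd (d_of C) f \subset Imd (d_of C) g])
  /\
  ([\/ C = Tid, C = T0, C = T1 | C = allops] ->
   (le_clone C f g <->
     [/\ ((C `<=` T0)%classic ->
            f (const_tuple n false) = g (const_tuple m false)),
         ((C `<=` T1)%classic ->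
            f (const_tuple n true) = g (const_tuple m true))
       & Im f \subset Im g])).
Proof.
have main : le_clone C f g <->
     [/\ ((C `<=` T0)%classic ->
            f (const_tuple n false) = g (const_tuple m false)),
         ((C `<=` T1)%classic ->
            f (const_tuple n true) = g (const_tuple m true))
       & Imd (d_of C) f \subset Imd (d_of C) g].
  split=> [[h [Ch ->]]|[fg0 fg1 /sub_Imd sub]].
    split=> [sub|sub|]; last apply/sub_Imd => a.
    - rewrite ffunE; congr (g _); apply: eq_from_tnth => i.
      by rewrite !tnth_mktuple; have [] := sub _ (Ch i).
    - rewrite ffunE; congr (g _); apply: eq_from_tnth => i.
      by rewrite !tnth_mktuple; have [] := sub _ (Ch i).
    exists [tuple (tnth h i) a | i < m]; rewrite !ffunE; split=> // sub.
    congr (g _); apply: eq_from_tnth => i.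
    by rewrite !tnth_mktuple; have [_ /= ->] := sub _ (Ch i).
  apply: lift_at_le_clone => // a.
  have neq_const : const_tuple n false <> const_tuple n true.
    by move=> /(congr1 (fun t => tnth t (Ordinal hn))); rewrite !tnth_const_tuple.
  have [[C0 a0]|n0] := pselect (C `<=` T0 /\ a = const_tuple n false).
    exists (const_tuple m false); rewrite a0; split=> // [|Cdual].
      by rewrite fg0.
    by rewrite !neg_const_tuple fg1 //; exact: (selfdual_T0_T1 Cdual).1.
  have [[C1 a1]|n1] := pselect (C `<=` T1 /\ a = const_tuple n true).
    exists (const_tuple m true); rewrite a1; split=> // [|Cdual|_ /esym //].
      by rewrite fg1.
    by rewrite !neg_const_tuple fg0 //; exact: (selfdual_T0_T1 Cdual).2.
  have [b [gb gnb]] := sub a; exists b; split=> // [C0 a0|C1 a1].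
    by case: n0.
  by case: n1.
split=> // Ccase.
have nCdual : ~ C `<=` selfdual.
  move=> Cdual; apply: Tid_not_selfdual => F; case=> F0 F1; apply: Cdual.
  by case: Ccase => -> //; case: F0.
rewrite main; split=> -[fg0 fg1 sub]; split=> //.
  by apply/sub_Im => a; have /sub_Imd/(_ a)[b [? _]] := sub; exists b.
by apply/sub_Imd => a; have /sub_Im/(_ a)[b ?] := sub; exists b.
Qed.
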